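(* Let $k$ be a field of characteristic zero and $B=k[x,y,z]$. Let $m\ge 2$, $n\ge 1$ be integers and $F\in k[t_1,t_2]$ with $F(t_1,0)\notin k$. Put $$f=xz-y^m,\qquad r=xF(x,f)+yf^n,\qquad h=\frac{f^{mn+1}+r^m}{x}\in B,$$ and let $E=E(m,n,F)=\mathrm{Jac}(f,h,\cdot)$. Then $E$ is a locally nilpotent derivation of $B$ with $\mathrm{rk}\,E=3$.
   Context: $\mathrm{Jac}(f,h,\cdot)$ is the derivation $p\mapsto\det J(f,h,p)$, where $J$ is the Jacobian matrix with respect to $x,y,z$. (Here $h$ is a polynomial.) The rank of a derivation $E$ of $k[x,y,z]$ is the least $i$ such that there is a coordinate system $(x_1,x_2,x_3)$, $k[x,y,z]=k[x_1,x_2,x_3]$, with $k[x_{i+1},\dots,x_3]\subseteq\mathrm{Ker}\,E$; rank $3$ means that no variable of $B$ lies in $\mathrm{Ker}\,E$. *)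

(* Defs.v *)
From HB Require Import structures.
From mathcomp Require Import all_boot all_order all_algebra.
From mathcomp Require Import mpoly.
Set Implicit Arguments. Unset Strict Implicit. Unset Printing Implicit Defensive.
Import Order.TTheory GRing.Theory Num.Theory.
Local Open Scope ring_scope.

Section Defs.
Variable k : fieldType.
Definition varx : {mpoly k[3]} := 'X_(inord 0).
Definition vary : {mpoly k[3]} := 'X_(inord 1).
Definition varz : {mpoly k[3]} := 'X_(inord 2).

Definition Jac (a b : {mpoly k[3]}) (p : {mpoly k[3]}) : {mpoly k[3]} :=
  \det (\matrix_(i < 3, j < 3) mderiv j (tnth [tuple a; b; p] i)).

Definition is_derivation (E : {mpoly k[3]} -> {mpoly k[3]}) : Prop :=
  (forall (c : k) (p q : {mpoly k[3]}), E (c *: p + q) = c *: E p + E q) /\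
  (forall p q : {mpoly k[3]}, E (p * q) = p * E q + q * E p).

Definition locally_nilpotent (E : {mpoly k[3]} -> {mpoly k[3]}) : Prop :=
  forall p : {mpoly k[3]}, exists N : nat, iter N E p = 0.

Definition coord_system (c : 3.-tuple {mpoly k[3]}) : Prop :=
  forall q : {mpoly k[3]}, exists g : {mpoly k[3]}, q = g \mPo c.

Definition only_vars_from (i : nat) (g : {mpoly k[3]}) : Prop :=
  forall mo, mo \in msupp g -> forall j : 'I_3, (j < i)%N -> mo j = 0%N.

(* there is a coordinate system (x_1,x_2,x_3) (here c_0,c_1,c_2) with
   k[x_{i+1},...,x_3] contained in Ker E *)
Definition rank_cond (E : {mpoly k[3]} -> {mpoly k[3]}) (i : nat) : Prop :=
  exists c : 3.-tuple {mpoly k[3]}, coord_system c /\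
    forall g : {mpoly k[3]}, only_vars_from i g -> E (g \mPo c) = 0.

Definition has_rank (E : {mpoly k[3]} -> {mpoly k[3]}) (r : nat) : Prop :=
  rank_cond E r /\ forall i : nat, (i < r)%N -> ~ rank_cond E i.
End Defs.

(* Main.v *)
Require Import Defs.
From HB Require Import structures.
From mathcomp Require Import all_boot all_order all_algebra.
From mathcomp Require Import mpoly.
From mathcomp Require Import ring.
From Stdlib Require Import Classical.
Import Order.TTheory GRing.Theory Num.Theory.
Local Open Scope ring_scope.
Set Implicit Arguments. Unset Strict Implicit. Unset Printing Implicit Defensive.

(* Let J = Jac(f, ., .). Differentiating x h = f^(mn+1) + r^m gives E f = E h = 0 and
   E r = - f^n h, while x, y, z all lie in k[f, h, r, 1/f, 1/h]; hence E is locally nilpotent and,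
   up to powers of f and h, its kernel is k[f, h].

   Suppose a variable v lies in Ker E, and let B = k[u, w, v]. Restricting to the x-axis inside the
   surface f = 0, where h becomes q(x) = x^(m-1) F(x,0)^m, one finds that v is a polynomial in f
   and h up to a power of h. Its restriction pi(x) to the axis is not constant, since v has nowhere
   vanishing gradient while f = 0 is singular at the origin. Choose beta with q(beta) <> 0 and
   restrict everything to the plane v = pi(beta), whose coordinate ring k[u, w] is factorial. There
   the component x = beta of the curve f = 0 has an equation g, which divides f and x - beta. As a
   factor of f, g is killed by the derivation induced by E, so g is again a polynomial in f and h
   up to a power of h. Evaluated on the axis, this makes q(x) - q(beta) divide x - beta, which is
   absurd because deg q >= 2. *)

(** * Derivations *)

Section Derivations.
Variables (B : comNzRingType) (E : B -> B).
Hypothesis ED : forall a b, E (a + b) = E a + E b.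
Hypothesis EM : forall a b, E (a * b) = a * E b + b * E a.

Lemma derivation0 : E 0 = 0.
Proof. by apply: (addrI (E 0)); rewrite -ED !addr0. Qed.

Lemma derivation1 : E 1 = 0.
Proof. by apply: (addrI (E 1)); rewrite addr0 -{3}[1]mulr1 EM !mul1r. Qed.

Lemma derivationN a : E (- a) = - E a.
Proof. by apply: (addrI (E a)); rewrite -ED !subrr derivation0. Qed.

Lemma derivation_natr n : E n%:R = 0.
Proof. by elim: n => [|n IH]; rewrite ?derivation0 // mulrS ED derivation1 IH addr0. Qed.

Lemma derivationX a n : E (a ^+ n) = n%:R * a ^+ n.-1 * E a.
Proof.
elim: n => [|n IH]; first by rewrite expr0 derivation1 !mul0r.
case: n IH => [|n] IH; first by rewrite !expr1 expr0 !mul1r.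
by rewrite exprS EM IH /= [in RHS]mulrS !exprS; ring.
Qed.

Lemma derivation_sum (I : Type) (s : seq I) (F : I -> B) :
  E (\sum_(i <- s) F i) = \sum_(i <- s) E (F i).
Proof. by apply: (big_morph _ ED derivation0). Qed.

Lemma iter_deriv0 n : iter n E 0 = 0.
Proof. by elim: n => //= n ->; rewrite derivation0. Qed.

Lemma iter_derivD n a b : iter n E (a + b) = iter n E a + iter n E b.
Proof. by elim: n => //= n ->; rewrite ED. Qed.

Lemma iter_deriv_const n a b : E a = 0 -> iter n E (a * b) = a * iter n E b.
Proof. by move=> Ea; elim: n => //= n ->; rewrite EM Ea mulr0 addr0. Qed.

Lemma iter_deriv_ge m n a : iter m E a = 0 -> (m <= n)%N -> iter n E a = 0.
Proof. by move=> Ea le_mn; rewrite -(subnK le_mn) iterD Ea iter_deriv0. Qed.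

(** General Leibniz rule. In the induction step [G1] and [G2] collect the two halves of the product
    rule, and Pascal's rule recombines them. *)
Lemma iter_derivM n a b :
  iter n E (a * b) = \sum_(i < n.+1) 'C(n, i)%:R * iter i E a * iter (n - i) E b.
Proof.
elim: n => [|n IH]; first by rewrite big_ord1 /= bin0 mul1r.
rewrite iterS IH derivation_sum.
pose G1 i := 'C(n, i)%:R * iter i E a * iter (n.+1 - i) E b.
pose G2 i := 'C(n, i)%:R * iter i.+1 E a * iter (n - i) E b.
rewrite (eq_bigr (fun i : 'I_n.+1 => G1 i + G2 i)); last first.
  move=> i _; rewrite /G1 /G2 -mulrA EM derivation_natr mulr0 addr0 EM.
  by rewrite subSn ?leq_ord //=; ring.
rewrite big_split /= [RHS]big_ord_recl [X in X + _ = _]big_ord_recl.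
rewrite [X in _ + X = _]big_ord_recr [X in _ = _ + X]big_ord_recr /=.
rewrite /G1 /G2 /= !bin0 !binn !subSS !subnn /=.
rewrite -!addrA; congr (_ + _); rewrite addrA; congr (_ + _).
rewrite -big_split; apply: eq_bigr => i _ /=.
rewrite /bump /= add1n binS natrD !subSS; ring.
Qed.

Lemma iter_deriv_mul m n a b :
  iter m E a = 0 -> iter n E b = 0 -> iter (m + n) E (a * b) = 0.
Proof.
move=> Ea Eb; rewrite iter_derivM big1 // => i _.
have [le_mi|lt_im] := leqP m i.
  by rewrite (iter_deriv_ge Ea le_mi) mulr0 mul0r.
by rewrite (iter_deriv_ge Eb) ?mulr0 // -addnBAC ?leq_addl // ltnW.
Qed.

(** * Factorial closedness of the kernel modulo an E-stable prime *)

Section FactoriallyClosed.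
Variables (S : idomainType) (psi : {rmorphism B -> S}).
Hypothesis char0S : forall n, n.+1%:R != 0 :> S.
Hypothesis psiE : forall a, psi a = 0 -> psi (E a) = 0.
Hypothesis Enil : forall a, exists n, iter n E a = 0.

Lemma psi_iter n a : psi a = 0 -> psi (iter n E a) = 0.
Proof. by move=> a0; elim: n => //= n /psiE. Qed.

(** The kernel of [psi] is stable under [E], so [E] induces a derivation on the image; [d] is the
    degree of [psi a] for it. *)
Lemma psi_top a : psi a != 0 ->
  exists d, psi (iter d E a) != 0 /\ psi (iter d.+1 E a) = 0.
Proof.
move=> a_neq0; have [n] := Enil a.
elim: n => [/= a0|n IH En]; first by rewrite a0 rmorph0 eqxx in a_neq0.
have [/eqP z|nz] := boolP (psi (iter n E a) == 0); last first.
  by exists n; rewrite En rmorph0.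
have {z}/psi_iter z := z.
suff [d dP] : exists d, (d <= n)%N && (psi (iter d E a) != 0) &&
    (psi (iter d.+1 E a) == 0).
  by exists d; case/andP: dP => /andP[_ ->] /eqP.
have ex : exists i, psi (iter i E a) == 0 by exists n; apply/eqP/(z 0%N).
case: (ex_minnP ex) => -[|d] /eqP dz dmin; first by rewrite dz eqxx in a_neq0.
exists d; rewrite dz eqxx andbT ltnW ?dmin ?(eqP (introT eqP (z 0%N))) //=.
by apply/negP => /dmin; rewrite ltnn.
Qed.

(** Degrees add: if [psi a] and [psi b] have degrees i and j, then in the Leibniz expansion of order
    i + j only the term (i, j) survives, with a nonzero binomial coefficient. Hence i > 0 would
    contradict [psi (E (a * b)) = 0]. *)
Lemma factorially_closed a b :
  psi (a * b) != 0 -> psi (E (a * b)) = 0 -> psi (E a) = 0.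
Proof.
rewrite rmorphM mulf_eq0 negb_or => /andP[/psi_top[i [ai ai1]] /psi_top[j [bj bj1]]].
case: i ai ai1 => [|i] ai ai1 Eab; first exact: ai1.
have: psi (iter (i.+1 + j) E (a * b)) = 0.
  by rewrite addSn iterSr psi_iter.
rewrite iter_derivM rmorph_sum /=.
have ltP : (i.+1 < (i.+1 + j).+1)%N by rewrite ltnS leq_addr.
rewrite (bigD1 (Ordinal ltP)) //= big1 ?addr0; last first.
  move=> l /negP nl; rewrite !rmorphM /=.
  case: (ltngtP l i.+1) => [l_lt|l_gt|l_eq].
  - rewrite [X in _ * X](_ : _ = 0) ?mulr0 //.
    have -> : (i.+1 + j - l = (i.+1 - l).-1 + j.+1)%N.
      move: (nat_of_ord l) l_lt => u u_lt.
      by rewrite addnS -addSn prednK ?subn_gt0 // addnBAC // ltnW.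
    by rewrite iterD psi_iter.
  - rewrite [X in _ * X * _](_ : _ = 0) ?mulr0 ?mul0r //.
    by rewrite -(subnK l_gt) iterD psi_iter.
  - by case: nl; apply/eqP/val_inj.
rewrite !rmorphM /= addKn rmorph_nat => /eqP.
rewrite !mulf_eq0 (negbTE ai) (negbTE bj) !orbF.
have: (0 < 'C(i.+1 + j, i.+1))%N by rewrite bin_gt0 leq_addr.
by case: 'C(_, _) => // p _; rewrite (negbTE (char0S p)).
Qed.

End FactoriallyClosed.
End Derivations.

(** * Bivariate polynomials *)

Lemma exists_min (T : Type) (P : T -> Prop) (mu : T -> nat) :
  (exists x, P x) -> exists x, P x /\ forall y, P y -> (mu x <= mu y)%N.
Proof.
case=> x0 Px0; move: {2}(mu x0) (leqnn (mu x0)) => n; elim: n x0 Px0 => [|n IH] x Px.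
  by rewrite leqn0 => /eqP x0; exists x; split=> // y _; rewrite x0.
move=> x_le; case: (classic (exists y, P y /\ (mu y < mu x)%N)) => [[y [Py y_lt]]|no].
  by apply: (IH y Py); rewrite -ltnS (leq_trans y_lt).
exists x; split=> // y Py; rewrite leqNgt; apply/negP => y_lt.
by apply: no; exists y.
Qed.

Section BivariateUFD.
Variable k : fieldType.
Implicit Types (p d : {poly k}) (G H Q : {poly {poly k}}).

(** Substitution k[u][w] -> T: the inner variable u goes to [a] and the outer variable w to [b]. *)
Definition bihorner (T : comAlgType k) (a b : T) G : T := (map_poly (horner_alg a) G).[b].

Lemma bihornerC (T : comAlgType k) (a b : T) p : bihorner a b p%:P = horner_alg a p.
Proof. by rewrite /bihorner map_polyC hornerC. Qed.

Lemma bihornerX (T : comAlgType k) (a b : T) : bihorner a b 'X = b.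
Proof. by rewrite /bihorner map_polyX hornerX. Qed.

Fact bihorner_is_zmod_morphism (T : comAlgType k) (a b : T) : zmod_morphism (bihorner a b).
Proof. by move=> G H; rewrite /bihorner rmorphB hornerD hornerN. Qed.

Fact bihorner_is_monoid_morphism (T : comAlgType k) (a b : T) : monoid_morphism (bihorner a b).
Proof. by split=> [|G H]; rewrite /bihorner ?rmorph1 ?hornerC // rmorphM hornerM. Qed.

HB.instance Definition _ (T : comAlgType k) (a b : T) :=
  GRing.isZmodMorphism.Build _ _ (bihorner a b) (bihorner_is_zmod_morphism a b).
HB.instance Definition _ (T : comAlgType k) (a b : T) :=
  GRing.isMonoidMorphism.Build _ _ (bihorner a b) (bihorner_is_monoid_morphism a b).

Lemma bihornerB (T : comAlgType k) (a b : T) G H :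
  bihorner a b (G - H) = bihorner a b G - bihorner a b H.
Proof. exact: rmorphB. Qed.

Lemma bihornerM (T : comAlgType k) (a b : T) G H :
  bihorner a b (G * H) = bihorner a b G * bihorner a b H.
Proof. exact: rmorphM. Qed.

Lemma horner_alg_comp (a p : {poly k}) : horner_alg a p = p \Po a.
Proof.
elim/poly_ind: p => [|p c IH]; first by rewrite rmorph0 comp_poly0.
rewrite comp_polyD comp_polyM comp_polyX comp_polyC -IH.
by rewrite rmorphD rmorphM /= horner_algX horner_algC -[_%:A]mul_polyC mulr1.
Qed.

Lemma comp_poly_neq0 (a p : {poly k}) : (1 < size a)%N -> p != 0 -> p \Po a != 0.
Proof. by move=> a_gt1; rewrite comp_poly_eq0. Qed.

Lemma irreducible_divisor d : (1 < size d)%N ->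
  exists p, irreducible_poly p /\ p %| d.
Proof.
move: {2}(size d) (leqnn (size d)) => n; elim: n d => [|n IH] d.
  by rewrite leqn0 => /eqP ->.
move=> d_le d_gt1; case: (classic (irreducible_poly d)) => [irr|nirr].
  by exists d.
have [q [q1 qd nqd]] : exists q : {poly k}, [/\ size q != 1%N, q %| d & ~~ (q %= d)].
  apply: NNPP => no; apply: nirr; split=> // q q1 qd.
  by apply/negPn/negP => nqd; apply: no; exists q.
have d0 : d != 0 by rewrite -size_poly_gt0 ltnW.
have q0 : q != 0 by apply: contraNneq d0 => q0; rewrite -dvd0p -q0.
have q_lt : (size q < size d)%N.
  by rewrite ltn_neqAle dvdp_leq // andbT dvdp_size_eqp.
have [||p [irr pq]] := IH q.
- by rewrite -ltnS (leq_trans q_lt).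
- by rewrite ltn_neqAle eq_sym q1 size_poly_gt0.
by exists p; split=> //; apply: dvdp_trans pq qd.
Qed.

Lemma dvdp_coefP p G : (forall i, p %| G`_i) -> exists H, G = p%:P * H.
Proof.
move=> pG; exists (\poly_(i < size G) (G`_i %/ p)).
apply/polyP => i; rewrite coefCM coef_poly; case: ltnP => [_|le].
  by rewrite mulrC divpK.
by rewrite nth_default // mulr0.
Qed.

(** Gauss's lemma. If i and j are the first indices where [p] fails to divide the coefficients of
    [G] and [H], it fails to divide the coefficient of index i + j of the product. *)
Lemma irreducible_prime_coef p G H : irreducible_poly p ->
  (forall i, p %| (G * H)`_i) -> (forall i, p %| G`_i) \/ (forall i, p %| H`_i).
Proof.
move=> irr pGH; apply: NNPP => /not_or_and[nG nH].
have first (K : {poly {poly k}}) : ~ (forall i, p %| K`_i) ->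
    exists i, ~~ (p %| K`_i) /\ forall j, (j < i)%N -> p %| K`_j.
  move=> nK; have ex : exists i, ~~ (p %| K`_i).
    by apply: NNPP => no; apply: nK => i; apply/negPn/negP => ni; apply: no; exists i.
  case: (ex_minnP ex) => i ni imin; exists i; split=> // j ji.
  by apply/negPn/negP => /imin; rewrite leqNgt ji.
have [i [ni iP]] := first _ nG; have [j [nj jP]] := first _ nH.
have := pGH (i + j)%N; rewrite coefM.
have ltP : (i < (i + j).+1)%N by rewrite ltnS leq_addr.
rewrite (bigD1 (Ordinal ltP)) //= addKn dvdp_addl; last first.
  apply: (big_ind (fun x => p %| x)) => [|x y px py|l nl]; first exact: dvdp0.
    by rewrite dvdp_add.
  have [li|il|li] := ltngtP (l : nat) i.
  - by rewrite dvdp_mulr ?iP.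
  - rewrite dvdp_mull // jP // ltn_subLR ?ltn_add2r //.
    by rewrite -ltnS.
  - by case/negP: nl; apply/eqP/val_inj.
have := irreducible_poly_coprime (G`_i) irr; rewrite ni => cop.
by rewrite Gauss_dvdpr // (negbTE nj).
Qed.

(** The irreducible factors of [d] are removed one at a time: each is prime in k[u][w] and does not
    divide the primitive [G], so it divides [Q]. *)
Lemma cancel_content G : (forall p, irreducible_poly p -> ~ forall i, p %| G`_i) ->
  forall d H Q, d != 0 -> d%:P * H = G * Q -> exists K, H = G * K.
Proof.
move=> prim d; move: {2}(size d) (leqnn (size d)) => n; elim: n d => [|n IH] d.
  by rewrite leqn0 size_poly_eq0 => ->.
move=> d_le H Q d0 dH; have [d_le1|d_gt1] := leqP (size d) 1.
  have /size_poly1P[c c0 dc] : size d == 1%N.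
    by rewrite eqn_leq d_le1 size_poly_gt0.
  exists (c^-1%:P%:P * Q); rewrite mulrCA -dH dc mulrA -!polyCM.
  by rewrite mulVf // mul1r.
have [p [irr /dvdpP[e de]]] := irreducible_divisor d_gt1.
have [|Gp|/dvdp_coefP[Q' QQ']] := @irreducible_prime_coef p G Q irr.
- by move=> i; rewrite -dH coefCM de -mulrA dvdp_mull // dvdp_mulr.
- by case: (prim p irr).
have p0 := irredp_neq0 irr.
have e0 : e != 0 by apply: contraNneq d0 => e0; rewrite de e0 mul0r.
apply: (IH e _ H Q') => //.
  rewrite -ltnS (leq_trans _ d_le) // de size_mul //.
  by case: irr => p_gt1 _; case: (size p) p_gt1 => [|[|s]] // _; rewrite !addnS /= ltnS leq_addr.
apply: (@mulfI _ p%:P); first by rewrite polyC_eq0.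
by rewrite mulrA -polyCM [p * e]mulrC -de dH QQ' mulrCA.
Qed.

(* A height-one prime of k[u][w] is principal: its generator is found by minimising first the
   degree in w, then the degree in u of the leading coefficient. *)
Lemma kernel_common_divisor (a b : {poly k}) G H :
  (1 < size a)%N || (1 < size b)%N -> G != 0 ->
  bihorner a b G = 0 -> bihorner a b H = 0 ->
  exists K, bihorner a b K = 0 /\ (exists G', G = K * G') /\ (exists H', H = K * H').
Proof.
move=> ab G0 Gk Hk; have [a_gt1|a_le1] := ltnP 1 (size a).
  pose P K := K != 0 /\ bihorner a b K = 0.
  have [K1 [[K10 K1k] K1min]] := @exists_min _ P (fun K => size K) (ex_intro _ G (conj G0 Gk)).
  have [K [[[K0 Kk] Ks] Kmin]] := @exists_min _ (fun K => P K /\ size K = size K1)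
    (fun K => size (lead_coef K)) (ex_intro _ K1 (conj (conj K10 K1k) erefl)).
  (* A factor [p] in k[u] has a nonzero image since [a] is nonconstant; dividing it out would stay
     in the kernel and lower the degree of the leading coefficient. *)
  have prim p : irreducible_poly p -> ~ forall i, p %| K`_i.
    move=> irr /dvdp_coefP[K' KK']; have p0 := irredp_neq0 irr.
    have K'0 : K' != 0 by apply: contraNneq K0 => z; rewrite KK' z mulr0.
    have sK' : size K' = size K by rewrite KK' mul_polyC size_scale.
    have : (size (lead_coef K) <= size (lead_coef K'))%N.
      apply: Kmin; split; last by rewrite sK'.
      split=> //; apply/eqP; move/eqP: Kk; rewrite KK' rmorphM mulf_eq0 => /orP[|//].
      by rewrite /= bihornerC horner_alg_comp (negbTE (comp_poly_neq0 _ _)).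
    rewrite KK' lead_coefM lead_coefC size_mul ?lead_coef_eq0 //.
    case: irr => p_gt1 _; case: (size p) p_gt1 => [|[|s]] // _.
    by rewrite !addSn /= ltnNge leq_addl.
  have dvd L : bihorner a b L = 0 -> exists L', L = K * L'.
    (* The pseudo-remainder lies in the kernel and has smaller degree in w than [K], so it vanishes;
       primitivity of [K] then cancels the multiplier [c]. *)
    move=> Lk; have E := Pdiv.Idomain.divp_eq L K.
    set c := _ ^+ _ in E; set R := Pdiv.Idomain.modp L K in E.
    have Rk : bihorner a b R = 0.
      move/(congr1 (bihorner a b)): E; rewrite -mul_polyC rmorphD !rmorphM /= Lk Kk !mulr0.
      by rewrite add0r.
    have R0 : R = 0.
      apply/eqP/negPn/negP => R0; have := K1min R (conj R0 Rk).
      by rewrite -Ks leqNgt Pdiv.Idomain.ltn_modp K0.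
    apply: (@cancel_content K prim c L (Pdiv.Idomain.divp L K)).
      by rewrite expf_neq0 // lead_coef_eq0.
    by rewrite mul_polyC E R0 addr0 mulrC.
  by exists K; do ?split=> //; apply: dvd.
have b_gt1 : (1 < size b)%N by move: ab; rewrite ltnNge a_le1.
have [l al] : exists l, a = l%:P by exists a`_0; apply: size1_polyC.
(* Here [a] is the constant [l], and u - l generates the kernel: setting u = l in a kernel element
   leaves a polynomial in w that vanishes at the nonconstant [b]. *)
exists ('X - l%:P)%:P; split.
  by rewrite bihornerC horner_alg_comp al comp_polyB comp_polyX comp_polyC subrr.
have dvd L : bihorner a b L = 0 -> exists L', L = ('X - l%:P)%:P * L'.
  move=> Lk; apply: dvdp_coefP => i; rewrite dvdp_XsubCl; apply/rootP.
  suff z : map_poly (horner_eval l) L = 0.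
    by have := coef_map (horner_eval l) L i; rewrite z coef0 /= /horner_eval => <-.
  apply/eqP/negPn/negP => /(comp_poly_neq0 b_gt1)/eqP; apply.
  rewrite -Lk /bihorner /comp_poly -map_poly_comp; congr (_.[_]).
  apply: eq_map_poly => p /=; rewrite horner_alg_comp al.
  by rewrite comp_polyCr /horner_eval.
by split; apply: dvd.
Qed.
End BivariateUFD.

(** * Coordinate systems *)

Section MPoly.
Variables (R : comNzRingType) (n : nat).

Lemma mpoly_ring_ind (P : {mpoly R[n]} -> Prop) :
  (forall c, P c%:MP) -> (forall i, P 'X_i) ->
  (forall a b, P a -> P b -> P (a + b)) -> (forall a b, P a -> P b -> P (a * b)) ->
  forall a, P a.
Proof.
move=> PC PX PD PM a; elim/mpolyind: a => [|c m p _ _ Pp]; first by rewrite -mpolyC0; apply: PC.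
apply: (PD) => //; rewrite -mul_mpolyC; apply: (PM) => //; rewrite mpolyXE_id.
have P1 : P 1 by rewrite -mpolyC1; apply: PC.
apply: (big_ind P) => [|a b|i _]; [exact: P1|exact: PM|].
elim: (m i) => [|d IH]; first by rewrite expr0.
by rewrite exprS; apply: PM.
Qed.

Lemma mderivXU (i j : 'I_n) : mderiv j ('X_i : {mpoly R[n]}) = (i == j)%:R.
Proof.
rewrite mderivX mnm1E; case: eqP => [->|_]; last by rewrite scale0r.
rewrite (_ : U_(j) - U_(j) = 0)%MM ?scale1r ?mpolyX0 //.
by apply/mnmP => l; rewrite mnmBE subnn mnm0E.
Qed.

(** Both sides are derivations along [ev] that agree on constants and variables. The derivation
    lives on the target, so the rule covers substitutions as well as evaluation along curves. *)
Lemma chain_rule (T : comNzRingType) (ev : {rmorphism {mpoly R[n]} -> T}) (d : T -> T) :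
  (forall a b, d (a + b) = d a + d b) -> (forall a b, d (a * b) = a * d b + b * d a) ->
  (forall c, d (ev c%:MP) = 0) ->
  forall p, d (ev p) = \sum_i ev (mderiv i p) * d (ev 'X_i).
Proof.
move=> dD dM dC; apply: mpoly_ring_ind => [c|i|a b IHa IHb|a b IHa IHb].
- by rewrite dC big1 // => i _; rewrite mderivC rmorph0 mul0r.
- rewrite (bigD1 i) //= mderivXU eqxx rmorph1 mul1r big1 ?addr0 // => j.
  by rewrite eq_sym mderivXU => /negbTE->; rewrite rmorph0 mul0r.
- rewrite rmorphD dD IHa IHb -big_split; apply: eq_bigr => i _ /=.
  by rewrite mderivD rmorphD mulrDl.
- rewrite rmorphM dM IHa IHb !mulr_sumr -big_split; apply: eq_bigr => i _ /=.
  by rewrite mderivM rmorphD !rmorphM /=; ring.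
Qed.
End MPoly.

Section Coordinates.
Variable k : fieldType.
Hypothesis char0 : forall n, n.+1%:R != 0 :> k.
Variable c : 3.-tuple {mpoly k[3]}.
Hypothesis cc : coord_system c.

Lemma mpoly_deriv_const n (p : {mpoly k[n]}) :
  (forall i, mderiv i p = 0) -> p = (p@_0)%:MP.
Proof.
move=> dp; apply/mpolyP => m; rewrite mcoeffC.
have [<-|m0] := eqVneq 0%MM m; first by rewrite mulr1.
rewrite mulr0; have [i mi] : exists i, (0 < m i)%N.
  apply: NNPP => no; case/eqP: m0; apply/mnmP => i; rewrite mnm0E.
  by case E: (m i) => // [j]; case: no; exists i; rewrite E.
have := mcoeff_mderiv i p (m - U_(i))%MM; rewrite dp mcoeff0 submK; last first.
  by apply/mnm_lepP => j; rewrite mnm1E; case: eqP => // <-.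
by move/eqP; rewrite eq_sym -mulr_natr mulf_eq0 (negbTE (char0 _)) orbF => /eqP.
Qed.

Lemma msize_mderiv n d (p : {mpoly k[n]}) i : (msize p <= d.+1)%N -> (msize (mderiv i p) <= d)%N.
Proof.
move=> p_le; rewrite msizeE; apply/bigmax_leqP_seq => m.
rewrite mcoeff_msupp mcoeff_mderiv => nz _.
have: (m + U_(i))%MM \in msupp p.
  by rewrite mcoeff_msupp; apply: contraNneq nz => ->; rewrite mul0rn.
by move/msize_mdeg_lt/leq_trans/(_ p_le); rewrite mdegD mdeg1 addn1 ltnS.
Qed.

(** Differentiating 'X_i = g_i(c) makes the Jacobian matrix of g, taken at c, a left inverse. *)
Lemma coord_jacobian : exists M : 'M[{mpoly k[3]}]_3,
  M *m (\matrix_(l, j) mderiv j (tnth c l)) = 1%:M.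
Proof.
have [g gP] := fin_all_exists (fun i : 'I_3 => cc 'X_i).
exists (\matrix_(i, l) (mderiv l (g i) \mPo c)); apply/matrixP => i j.
rewrite !mxE -mderivXU gP.
rewrite (@chain_rule _ _ _ (comp_mpoly c) (mderiv j)); first last.
- by move=> a; rewrite /= comp_mpolyC mderivC.
- by move=> a b; rewrite mderivM addrC mulrC [b * _]mulrC.
- exact: mderivD.
by apply: eq_bigr => l _; rewrite !mxE /= comp_mpolyXU -tnth_nth.
Qed.

Lemma coord_grad (T : comNzRingType) (ev : {rmorphism {mpoly k[3]} -> T}) i :
  ~ (forall j, ev (mderiv j (tnth c i)) = 0).
Proof.
move=> z; have [M /mulmx1C/matrixP/(_ i i)] := coord_jacobian.
rewrite !mxE eqxx => /(congr1 ev)/eqP; rewrite rmorph_sum big1 ?rmorph1 ?(eq_sym 0) ?oner_eq0 //.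
by move=> j _; rewrite rmorphM !mxE /= z mul0r.
Qed.

(** Induction on the degree: differentiating p(c) = 0 and inverting the Jacobian shows that every
    partial derivative of [p] vanishes at c, hence is zero, so [p] is constant in characteristic
    zero. *)
Lemma coord_inj (p : {mpoly k[3]}) : p \mPo c = 0 -> p = 0.
Proof.
move: {2}(msize p) (leqnn (msize p)) => d; elim: d p => [|d IH] p p_le pc.
  by apply/eqP; rewrite -msize_poly_eq0 -leqn0.
suff dp i : mderiv i p = 0.
  by move: pc; rewrite (mpoly_deriv_const dp) comp_mpolyC.
apply: IH; first exact: msize_mderiv.
have [M MJ] := coord_jacobian; have {MJ}JM := mulmx1C MJ.
pose u : 'rV[{mpoly k[3]}]_3 := \row_l (mderiv l p \mPo c).
suff u0 : u = 0 by move/rowP/(_ i): u0; rewrite !mxE.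
rewrite -[u]mulmx1 -JM mulmxA; set w := u *m _; suff -> : w = 0 by rewrite mul0mx.
apply/rowP => j; rewrite mxE [RHS]mxE.
transitivity (mderiv j (p \mPo c)); last by rewrite pc mderiv0.
rewrite (@chain_rule _ _ _ (comp_mpoly c) (mderiv j)); first last.
- by move=> a; rewrite /= comp_mpolyC mderivC.
- by move=> a b; rewrite mderivM addrC mulrC [b * _]mulrC.
- exact: mderivD.
by apply: eq_bigr => l _; rewrite !mxE /= comp_mpolyXU -tnth_nth.
Qed.

Lemma coord_ind (P : {mpoly k[3]} -> Prop) :
  (forall a, P a%:MP) -> (forall i, P (tnth c i)) ->
  (forall a b, P a -> P b -> P (a + b)) -> (forall a b, P a -> P b -> P (a * b)) ->
  forall a, P a.
Proof.
move=> PC PX PD PM a; have [g ->] := cc a.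
elim/mpoly_ring_ind: g => [e|i|g1 g2 IH1 IH2|g1 g2 IH1 IH2].
- by rewrite comp_mpolyC.
- by rewrite comp_mpolyXU -tnth_nth.
- by rewrite comp_mpolyD; apply: PD.
- by rewrite rmorphM; apply: PM.
Qed.

(** The map evaluates the [g i], which express the variables through [c], at the prescribed values
    [t]; it is correct because [g] is also inverse to [c] on the other side ([cg]), which follows
    from [coord_inj]. *)
Lemma coord_rmorph (T : comNzRingType) (h : {rmorphism k -> T}) (t : 'I_3 -> T) :
  exists psi : {rmorphism {mpoly k[3]} -> T},
    (forall a, psi a%:MP = h a) /\ (forall i, psi (tnth c i) = t i).
Proof.
have [g gP] := fin_all_exists (fun i : 'I_3 => cc 'X_i).
pose gt := [tuple g i | i < 3].
have cg i : tnth c i \mPo gt = 'X_i.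
  apply/eqP; rewrite -subr_eq0; apply/eqP/coord_inj; rewrite comp_mpolyB comp_mpolyXU -tnth_nth.
  apply/eqP; rewrite subr_eq0; apply/eqP.
  elim/mpoly_ring_ind: (tnth c i) => [a|j|a b IHa IHb|a b IHa IHb].
  - by rewrite !comp_mpolyC.
  - by rewrite comp_mpolyXU -tnth_nth tnth_mktuple -gP.
  - by rewrite !comp_mpolyD IHa IHb.
  - by rewrite !rmorphM /= IHa IHb.
pose ev (u : 'I_3 -> T) : {rmorphism {mpoly k[3]} -> T} := mmap h u.
have evC u a : ev u a%:MP = h a by exact: mmapC.
have evX u i : ev u 'X_i = u i by rewrite /ev /= mmapX mmap1U.
exists (ev (fun i => ev t (g i))); split=> // i.
transitivity (ev t (tnth c i \mPo gt)); last by rewrite cg evX.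
elim/mpoly_ring_ind: (tnth c i) => [a|j|a b IHa IHb|a b IHa IHb].
- by rewrite comp_mpolyC !evC.
- by rewrite comp_mpolyXU -tnth_nth tnth_mktuple evX.
- by rewrite !rmorphD /= IHa IHb.
- by rewrite !rmorphM /= IHa IHb.
Qed.
End Coordinates.

(** * The derivation E *)

Lemma det_mx3 (T : comNzRingType) (A : 'M[T]_3) :
  let a i j := A (inord i) (inord j) in
  \det A = a 0%N 0%N * (a 1%N 1%N * a 2%N 2%N - a 1%N 2%N * a 2%N 1%N)
         - a 0%N 1%N * (a 1%N 0%N * a 2%N 2%N - a 1%N 2%N * a 2%N 0%N)
         + a 0%N 2%N * (a 1%N 0%N * a 2%N 1%N - a 1%N 1%N * a 2%N 0%N).
Proof.
have e0 : ord0 = inord 0 :> 'I_3 by apply: val_inj; rewrite /= inordK.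
have e1 : lift ord0 ord0 = inord 1 :> 'I_3 by apply: val_inj; rewrite /= inordK.
have e2 : lift ord0 (lift ord0 ord0) = inord 2 :> 'I_3 by apply: val_inj; rewrite /= inordK.
have l21 : lift (lift ord0 ord0 : 'I_3) ord0 = ord0 by apply: val_inj.
have l31 : lift (lift ord0 (lift ord0 ord0) : 'I_3) ord0 = ord0 by apply: val_inj.
have l22 : lift (lift ord0 ord0 : 'I_3) (lift ord0 ord0) = lift ord0 (lift ord0 ord0)
  by apply: val_inj.
have l32 : lift (lift ord0 (lift ord0 ord0) : 'I_3) (lift ord0 ord0) = lift ord0 ord0
  by apply: val_inj.
have l2 : lift (lift ord0 ord0 : 'I_2) ord0 = ord0 by apply: val_inj.
move=> a.
rewrite (expand_det_row _ ord0) !big_ord_recl big_ord0 /cofactor.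
rewrite !(expand_det_row _ (ord0 : 'I_2)) !big_ord_recl !big_ord0 /cofactor !det_mx11 !mxE.
rewrite !l2 !l21 !l22 !l31 !l32 e2 e1 e0 /a /= /bump /= !inordK //.
ring.
Qed.

(** * Jacobian derivations in three variables *)

Section Jacobian.
Variable k : fieldType.
Local Notation B := {mpoly k[3]}.
Local Notation d0 := (mderiv (inord 0 : 'I_3)).
Local Notation d1 := (mderiv (inord 1 : 'I_3)).
Local Notation d2 := (mderiv (inord 2 : 'I_3)).

Lemma Jac_expand (a b p : B) : Jac a b p =
  d0 a * (d1 b * d2 p - d2 b * d1 p) - d1 a * (d0 b * d2 p - d2 b * d0 p)
  + d2 a * (d0 b * d1 p - d1 b * d0 p).
Proof.
rewrite /Jac det_mx3 !mxE.
have t0 : tnth [tuple a; b; p] (inord 0) = a by rewrite (tnth_nth 0) inordK.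
have t1 : tnth [tuple a; b; p] (inord 1) = b by rewrite (tnth_nth 0) inordK.
have t2 : tnth [tuple a; b; p] (inord 2) = p by rewrite (tnth_nth 0) inordK.
by rewrite t0 t1 t2.
Qed.

Ltac generalize_mderiv :=
  repeat match goal with |- context [mderiv ?i ?p] => generalize (mderiv i p); intro end.

Lemma JacDm (a b c p : B) : Jac a (b + c) p = Jac a b p + Jac a c p.
Proof. by rewrite !Jac_expand !mderivD; generalize_mderiv; ring. Qed.

Lemma JacMm (a b c p : B) : Jac a (b * c) p = b * Jac a c p + c * Jac a b p.
Proof. by rewrite !Jac_expand !mderivM; generalize_mderiv; ring. Qed.

Lemma Jac_swap (a b p : B) : Jac a b p = - Jac a p b.
Proof. by rewrite !Jac_expand; generalize_mderiv; ring. Qed.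

Lemma Jac_diagl (a p : B) : Jac a a p = 0.
Proof. by rewrite !Jac_expand; generalize_mderiv; ring. Qed.

Lemma Jac_diagr (a p : B) : Jac a p p = 0.
Proof. by rewrite !Jac_expand; generalize_mderiv; ring. Qed.

Lemma JacD (a b p q : B) : Jac a b (p + q) = Jac a b p + Jac a b q.
Proof. by rewrite !Jac_expand !mderivD; generalize_mderiv; ring. Qed.

Lemma JacM (a b p q : B) : Jac a b (p * q) = p * Jac a b q + q * Jac a b p.
Proof. by rewrite !Jac_expand !mderivM; generalize_mderiv; ring. Qed.

Lemma JacC (a b : B) (c : k) : Jac a b c%:MP = 0.
Proof. by rewrite !Jac_expand !mderivC; generalize_mderiv; ring. Qed.

Lemma JacZ (a b p : B) (c : k) : Jac a b (c *: p) = c *: Jac a b p.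
Proof. by rewrite -!mul_mpolyC JacM JacC mulr0 addr0. Qed.

Lemma Jac_is_derivation (a b : B) : is_derivation (Jac a b).
Proof. by split=> [c p q|p q]; rewrite ?JacM // JacD JacZ. Qed.
End Jacobian.

(** * Local nilpotence of E and its kernel *)

Section Construction.
Variable k : fieldType.
Local Notation B := {mpoly k[3]}.
Variables (m n : nat) (F : {mpoly k[2]}).
Let x : B := varx k.
Let y : B := vary k.
Let z : B := varz k.
Let f : B := x * z - y ^+ m.
Let F' : B := F \mPo [tuple x; f].
Let r : B := x * F' + y * f ^+ n.

Lemma varx_neq0 : x != 0.
Proof.
apply/eqP => x0; have := mderivXU k (inord 0 : 'I_3) (inord 0).
by rewrite -[X in mderiv _ X]/x x0 mderiv0 eqxx => /eqP; rewrite eq_sym oner_eq0.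
Qed.

(* Modulo x, r = y f^n and f = - y^m. *)
Lemma exists_h : exists h, x * h = f ^+ (m * n + 1) + r ^+ m.
Proof.
(* The cofactor in r^m - (y f^n)^m = (r - y f^n) s, where r - y f^n = x F'. The rest is f^(mn) (f +
   y^m) = x z f^(mn). *)
pose s := \sum_(i < m) r ^+ (m.-1 - i) * (y * f ^+ n) ^+ i.
exists (z * f ^+ (m * n) + F' * s).
have -> : r ^+ m = (y * f ^+ n) ^+ m + x * F' * s.
  by rewrite -[LHS](subrK ((y * f ^+ n) ^+ m)) subrXX addrC {1}/r addrK.
rewrite exprMn -exprM [(n * m)%N]mulnC addn1 exprS {2}/f; ring.
Qed.

Variable h : B.
Hypothesis xh : x * h = f ^+ (m * n + 1) + r ^+ m.
Local Notation E := (Jac f h).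

Let ED := @JacD k f h.
Let EM := @JacM k f h.

Lemma E_f : E f = 0.
Proof. by rewrite Jac_swap Jac_diagl oppr0. Qed.

Lemma E_h : E h = 0.
Proof. exact: Jac_diagr. Qed.

Lemma mderiv_z_f : mderiv (inord 2) f = x.
Proof.
have i02 : ((inord 0 : 'I_3) == inord 2) = false by apply/eqP => /(congr1 val); rewrite /= !inordK.
have i12 : ((inord 1 : 'I_3) == inord 2) = false by apply/eqP => /(congr1 val); rewrite /= !inordK.
rewrite /f mderivB mderivM /x /z /varx /varz !mderivXU eqxx i02.
rewrite (derivationX (E := mderiv (inord 2))) => [|a b].
  by rewrite /y /vary mderivXU i12 /= mulr0 mul0r add0r mulr1 subr0.
by rewrite mderivM addrC [b * _]mulrC.
Qed.

Lemma Jac_f_y_x : Jac f y x = - x.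
Proof.
have i01 : ((inord 0 : 'I_3) == inord 1) = false by apply/eqP => /(congr1 val); rewrite /= !inordK.
have i02 : ((inord 0 : 'I_3) == inord 2) = false by apply/eqP => /(congr1 val); rewrite /= !inordK.
have i12 : ((inord 1 : 'I_3) == inord 2) = false by apply/eqP => /(congr1 val); rewrite /= !inordK.
have i10 : ((inord 1 : 'I_3) == inord 0) = false by rewrite eq_sym.
rewrite Jac_expand /x /y /varx /vary !mderivXU !(i01, i02, i12, i10, eqxx).
rewrite mderiv_z_f.
by rewrite /x /varx /= ; ring.
Qed.

(** The derivation b -> Jac(f, b, x) kills x and f, hence F(x, f); only the term y f^n of r
    contributes. *)
Lemma Jac_f_r_x : Jac f r x = - (x * f ^+ n).
Proof.
pose d b := Jac f b x.
have dD a b : d (a + b) = d a + d b by exact: JacDm.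
have dM a b : d (a * b) = a * d b + b * d a by exact: JacMm.
have dx : d x = 0 by exact: Jac_diagr.
have df : d f = 0 by exact: Jac_diagl.
have dF : d F' = 0.
  have dC c : d (comp_mpoly [tuple x; f] c%:MP) = 0.
    by rewrite comp_mpolyC /d Jac_swap JacC oppr0.
  rewrite (chain_rule (ev := comp_mpoly [tuple x; f]) dD dM dC).
  rewrite !big_ord_recl big_ord0 /= !comp_mpolyXU /=.
  by rewrite -/x -/f dx df !mulr0 !addr0.
rewrite -/(d r) /r dD !dM dF dx (derivationX dM) df /d Jac_f_y_x; ring.
Qed.

(** The derivation b -> Jac(f, b, r) kills f and r, hence x h; the product rule expresses x E(r)
    through [Jac_f_r_x], and x cancels. *)
Lemma E_r : E r = - (h * f ^+ n).
Proof.
apply: (mulfI varx_neq0).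
pose d b := Jac f b r.
have dD a b : d (a + b) = d a + d b by exact: JacDm.
have dM a b : d (a * b) = a * d b + b * d a by exact: JacMm.
have : d (x * h) = 0.
  by rewrite xh dD !(derivationX dM) /d Jac_diagl Jac_diagr !mulr0 addr0.
rewrite dM {2}/d Jac_swap Jac_f_r_x /d => e.
by apply/eqP; rewrite -subr_eq0; apply/eqP; rewrite -e; ring.
Qed.

(* x = (f^(mn+1) + r^m) / h, y = (r - x F') / f^n and z = (f + y^m) / x all lie in
   k[f, h, r, 1/f, 1/h]. *)
Lemma fhr_ind (P : B -> Prop) :
  (forall c, P c%:MP) -> (forall a b, P a -> P b -> P (a + b)) ->
  (forall a b, P a -> P b -> P (a * b)) -> P f -> P h -> P r ->
  (forall a, P (f * a) -> P a) -> (forall a, P (h * a) -> P a) -> forall a, P a.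
Proof.
move=> PC PD PM Pf Ph Pr Cf Ch.
have PX a i : P a -> P (a ^+ i).
  move=> Pa; elim: i => [|i IH]; first by rewrite expr0 -mpolyC1; apply: PC.
  by rewrite exprS; apply: PM.
have PN a : P a -> P (- a).
  by move=> Pa; rewrite -mulN1r -mpolyC1 -mpolyCN; apply: (PM).
have CfX i a : P (f ^+ i * a) -> P a.
  by elim: i => [|i IH]; rewrite ?expr0 ?mul1r // exprS -mulrA => /Cf.
have Px : P x by apply: Ch; rewrite mulrC xh; apply: PD; apply: PX.
have PF : P F'.
  rewrite /F'; elim/mpoly_ring_ind: F => [c|i|a b Pa Pb|a b Pa Pb].
  - by rewrite comp_mpolyC.
  - by rewrite comp_mpolyXU; case: i => -[|[|]].
  - by rewrite comp_mpolyD; apply: PD.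
  - by rewrite rmorphM; apply: PM.
have fy : f ^+ n * y = r - x * F' by rewrite /r; ring.
have Pfy : P (f ^+ n * y) by rewrite fy; apply: (PD) => //; apply/PN/PM.
have Py : P y by apply: CfX Pfy.
have Pz : P z.
  apply: (CfX (m * n)%N).
  (* Comes from x f^(mn) z = f^(mn+1) + (f^n y)^m by replacing f^n y with r - x F' and dividing by
     x. *)
  have -> : f ^+ (m * n) * z =
      h - F' * \sum_(i < m) (f ^+ n * y) ^+ (m.-1 - i) * r ^+ i.
    apply: (mulfI varx_neq0); set s := \sum_(_ < _) _.
    have e : (f ^+ n * y) ^+ m = r ^+ m - x * F' * s.
      rewrite -[LHS](subrK (r ^+ m)) subrXX -/s fy; ring.
    have {1}-> : x * (f ^+ (m * n) * z) = f ^+ (m * n + 1) + (f ^+ n * y) ^+ m.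
      by rewrite exprMn -exprM [(n * m)%N]mulnC addn1 exprS {2}/f; ring.
    by rewrite e mulrBr xh; ring.
  apply: (PD) => //; apply/PN/PM => //; apply: (big_ind P) => // [|i _].
    by rewrite -mpolyC0.
  by apply: PM; apply: PX.
elim/mpoly_ring_ind => // i.
have -> : i = inord i by rewrite inord_val.
by case: i => -[|[|[|//]]].
Qed.

Lemma f_neq0 : f != 0.
Proof.
apply/eqP => f0; have /eqP := Jac_f_y_x; apply/negP.
rewrite Jac_expand f0 !mderiv0 !mul0r subrr addr0.
by rewrite eq_sym oppr_eq0 varx_neq0.
Qed.

(** Elements killed by a power of E are closed under ring operations and under cancelling the
    nonzero kernel elements f and h. They contain f, h, and also r, since E(r) is in the kernel. *)
Lemma E_nilpotent : h != 0 -> locally_nilpotent E.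
Proof.
move=> h0; apply: fhr_ind.
- by move=> c; exists 1%N; rewrite /= JacC.
- move=> a b [i ai] [j bj]; exists (i + j)%N; rewrite iter_derivD //.
  by rewrite (iter_deriv_ge ED ai) ?leq_addr // (iter_deriv_ge ED bj) ?leq_addl // addr0.
- by move=> a b [i ai] [j bj]; exists (i + j)%N; rewrite iter_deriv_mul.
- by exists 1%N; rewrite /= E_f.
- by exists 1%N; rewrite /= E_h.
- exists 2%N; rewrite /= E_r (derivationN ED) EM E_h (derivationX EM) E_f !mulr0 addr0.
  exact: oppr0.
- move=> a [i]; rewrite (iter_deriv_const EM) ?E_f // => /eqP.
  by rewrite mulf_eq0 (negbTE f_neq0) => /eqP; exists i.
- move=> a [i]; rewrite (iter_deriv_const EM) ?E_h // => /eqP.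
  by rewrite mulf_eq0 (negbTE h0) => /eqP; exists i.
Qed.

Local Notation A := {poly {poly k}}.
Local Notation fh := (bihorner h f).

Lemma E_fh (a : A) : E (fh a) = 0.
Proof.
elim/poly_ind: a => [|a c IH]; first by rewrite rmorph0 (derivation0 ED).
rewrite rmorphD rmorphM /= bihornerX bihornerC ED EM E_f IH !mulr0 !add0r.
elim/poly_ind: c => [|c e IHc]; first by rewrite rmorph0 (derivation0 ED).
rewrite rmorphD rmorphM /= horner_algX horner_algC ED EM E_h IHc !mulr0 !add0r.
by rewrite JacZ (derivation1 EM) scaler0.
Qed.

Lemma iter_E_horner i (S : {poly A}) :
  iter i E (map_poly fh S).[r] = E r ^+ i * (map_poly fh S^`(i)).[r].
Proof.
have EEr : E (E r) = 0.
  by rewrite E_r (derivationN ED) EM E_h (derivationX EM) E_f !mulr0 addr0 oppr0.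
have E1 (Q : {poly A}) : E (map_poly fh Q).[r] = E r * (map_poly fh Q^`()).[r].
  elim/poly_ind: Q => [|Q c IH]; first by rewrite deriv0 !rmorph0 !horner0 (derivation0 ED) mulr0.
  rewrite derivD derivM derivX derivC addr0 mulr1 !rmorphD !rmorphM /= map_polyX map_polyC /=.
  by rewrite !hornerE ED EM E_fh IH; ring.
elim: i => [|i IH]; first by rewrite expr0 mul1r derivn0.
by rewrite iterS IH EM E1 (derivationX EM) EEr mulr0 mulr0 addr0 derivnS exprS; ring.
Qed.

(** After inverting f and h the ring becomes k[f, h][r]; all denominators are collected in one power
    of f h. *)
Lemma localization (b : B) : exists N (S : {poly A}), (f * h) ^+ N * b = (map_poly fh S).[r].
Proof.
pose ev (S : {poly A}) : B := (map_poly fh S).[r].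
have evM S Q : ev (S * Q) = ev S * ev Q by rewrite /ev rmorphM hornerM.
have evD S Q : ev (S + Q) = ev S + ev Q by rewrite /ev rmorphD hornerD.
have evC (a : A) : ev a%:P = fh a by rewrite /ev map_polyC hornerC.
pose fhA : A := 'X * ('X)%:P.
have evfh N : ev (fhA ^+ N)%:P = (f * h) ^+ N.
  by rewrite evC rmorphXn rmorphM /= bihornerX bihornerC horner_algX.
elim/fhr_ind: b =>
  [c|a b [N1 [S1 e1]] [N2 [S2 e2]]|a b [N1 [S1 e1]] [N2 [S2 e2]]||||a [N [S e]]|a [N [S e]]].
- exists 0%N, (c%:P%:P)%:P; rewrite expr0 mul1r -[RHS]/(ev _) evC bihornerC horner_algC.
  by rewrite -mul_mpolyC mulr1.
- exists (N1 + N2)%N, ((fhA ^+ N2)%:P * S1 + (fhA ^+ N1)%:P * S2).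
  rewrite -[RHS]/(ev _) evD !evM !evfh -[ev S1]e1 -[ev S2]e2 exprD; ring.
- exists (N1 + N2)%N, (S1 * S2).
  rewrite -[RHS]/(ev _) evM -[ev S1]e1 -[ev S2]e2 exprD; ring.
- by exists 0%N, ('X%:P); rewrite expr0 mul1r -[RHS]/(ev _) evC bihornerX.
- by exists 0%N, ('X%:P%:P); rewrite expr0 mul1r -[RHS]/(ev _) evC bihornerC horner_algX.
- by exists 0%N, 'X; rewrite expr0 mul1r map_polyX hornerX.
- exists N.+1, (('X%:P)%:P * S).
  rewrite -[RHS]/(ev _) evM evC bihornerC horner_algX -[ev S]e exprS; ring.
- exists N.+1, ('X%:P * S); rewrite -[RHS]/(ev _) evM evC bihornerX -[ev S]e exprS; ring.
Qed.

(* E acts on k[f, h][r] as E(r) d/dr. *)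
Lemma kernel_mod (S : idomainType) (psi : {rmorphism B -> S}) g :
  (forall i, i.+1%:R != 0 :> S) -> psi f != 0 -> psi h != 0 ->
  (forall a, psi a = 0 -> psi (E a) = 0) -> psi (E g) = 0 ->
  exists N (a : A), psi ((f * h) ^+ N * g) = psi (fh a).
Proof.
move=> char0 f0 h0 psiE Eg; have [N [Q e]] := localization g.
exists N, Q`_0; rewrite e.
have Er0 : psi (E r) != 0 by rewrite E_r rmorphN rmorphM rmorphXn oppr_eq0 mulf_neq0 ?expf_neq0.
pose p := map_poly (psi \o fh) Q.
have pr : p.[psi r] = psi (map_poly fh Q).[r] by rewrite /p map_poly_comp horner_map.
have p0 : psi (fh Q`_0) = p`_0 by rewrite coef_map.
(* By [iter_E_horner], applying E i times gives E(r)^i times the i-th derivative at r, and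
   [psi (E r)] is nonzero. *)
have pz i : (0 < i)%N -> p^`(i).[psi r] = 0.
  case: i => // i _; apply: (mulfI (expf_neq0 i.+1 Er0)); rewrite mulr0.
  rewrite /p derivn_map map_poly_comp horner_map -rmorphXn -rmorphM -iter_E_horner -e.
  rewrite iterSr (psi_iter psiE) // EM (derivationX EM) EM E_f E_h !mulr0 addr0 mulr0 mulr0 addr0.
  by rewrite rmorphM Eg mulr0.
suff p1 : (size p <= 1)%N by rewrite -pr p0 (size1_polyC p1) hornerC coefC.
rewrite leqNgt; apply/negP => p_gt1.
(* The derivative of order deg p is constant, and nonzero in characteristic zero, so [pz] excludes a
   positive degree. *)
have : p^`((size p).-1) = (lead_coef p *+ ((size p).-1)`!)%:P.
  apply/polyP => i; rewrite coef_derivn coefC; case: i => [|i] /=.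
    by rewrite addn0 ffactnn.
  rewrite nth_default ?mul0rn //.
  by case: (size p) p_gt1 => // d _; rewrite /= addnS ltnS leq_addr.
move/(congr1 (fun s => s.[psi r])); rewrite pz; last by case: (size p) p_gt1 => [|[|]].
rewrite hornerC => /eqP; rewrite eq_sym -mulr_natr mulf_eq0 lead_coef_eq0 -size_poly_eq0.
case: (size p) p_gt1 => // d _ /=; have := fact_gt0 d.
by case: (d`!) => // j _; rewrite (negbTE (char0 j)).
Qed.

End Construction.

(** * Restriction to the surface f = 0 *)

Section Evaluation.
Variable k : fieldType.
Local Notation B := {mpoly k[3]}.
Implicit Types a b c d p q s : {poly k}.

(** Restriction to the parametrised curve t -> (a(t), b(t), c(t)). *)
Definition eval3 a b c : {rmorphism B -> {poly k}} :=
  mmap (@polyC k) (fun i : 'I_3 => nth 0 [:: a; b; c] i).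

Lemma eval3C a b c e : eval3 a b c e%:MP = e%:P.
Proof. exact: mmapC. Qed.

Lemma eval3X a b c i : eval3 a b c 'X_i = nth 0 [:: a; b; c] i.
Proof. by rewrite /eval3 /= mmapX mmap1U. Qed.

Lemma eval3x a b c : eval3 a b c (varx k) = a.
Proof. by rewrite eval3X inordK. Qed.

Lemma eval3y a b c : eval3 a b c (vary k) = b.
Proof. by rewrite eval3X inordK. Qed.

Lemma eval3z a b c : eval3 a b c (varz k) = c.
Proof. by rewrite eval3X inordK. Qed.

Lemma eval3_comp a b c d (p : B) :
  eval3 a b c p \Po d = eval3 (a \Po d) (b \Po d) (c \Po d) p.
Proof.
elim/mpoly_ring_ind: p => [e|i|p1 p2 IH1 IH2|p1 p2 IH1 IH2].
- by rewrite !eval3C comp_polyC.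
- by rewrite !eval3X; case: i => -[|[|[|//]]].
- by rewrite !rmorphD /= -IH1 -IH2.
- by rewrite !rmorphM /= -IH1 -IH2.
Qed.

(** Transfers values between two curves through a common point. *)
Lemma eval3_horner a b c a' b' c' e e' (p : B) :
  a.[e] = a'.[e'] -> b.[e] = b'.[e'] -> c.[e] = c'.[e'] ->
  (eval3 a b c p).[e] = (eval3 a' b' c' p).[e'].
Proof.
move=> ea eb ec; apply: polyC_inj.
by rewrite -!comp_polyCr !eval3_comp !comp_polyCr ea eb ec.
Qed.

Lemma eval3_deriv a b c (p : B) : (eval3 a b c p)^`() =
  eval3 a b c (mderiv (inord 0) p) * a^`() + eval3 a b c (mderiv (inord 1) p) * b^`()
  + eval3 a b c (mderiv (inord 2) p) * c^`().
Proof.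
rewrite (chain_rule (ev := eval3 a b c) (d := @deriv k)) => [|u v|u v|e].
- rewrite !big_ord_recl big_ord0 addr0 !eval3X addrA /=.
  have -> : inord 0 = ord0 :> 'I_3 by apply: val_inj; rewrite /= inordK.
  have -> : inord 1 = lift ord0 ord0 :> 'I_3 by apply: val_inj; rewrite /= inordK.
  by have -> : inord 2 = lift ord0 (lift ord0 ord0) :> 'I_3 by apply: val_inj; rewrite /= inordK.
- exact: derivD.
- by rewrite derivM addrC [v * _]mulrC.
- by rewrite eval3C derivC.
Qed.

(** The remainder of [s] modulo [p], composed with [q], would be a multiple of p(q) of smaller
    degree. *)
Lemma dvdp_comp_inv p q s : (1 < size q)%N -> p \Po q %| s \Po q -> p %| s.
Proof.
move=> q1 pqs; rewrite /dvdp; apply/negPn/negP => r0.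
have pr : p \Po q %| (s %% p) \Po q.
  move: pqs; rewrite {1}(divp_eq s p) comp_polyD comp_polyM dvdp_addr //.
  exact: dvdp_mull.
have rq0 : (s %% p) \Po q != 0 by apply: comp_poly_neq0.
have p0 : p != 0.
  by apply: contraNneq rq0 => p0; move: pr; rewrite p0 comp_poly0 dvd0p.
have := dvdp_leq rq0 pr; apply/negP; rewrite -ltnNge.
have size_comp u : u != 0 -> size (u \Po q) = ((size u).-1 * (size q).-1).+1.
  by move=> u0; rewrite -size_comp_poly prednK // size_poly_gt0 comp_poly_neq0.
have q_gt0 : (0 < (size q).-1)%N by case: (size q) q1 => [|[|]].
rewrite !size_comp // ltnS ltn_pmul2r //.
by rewrite -ltnS !prednK ?size_poly_gt0 // ltn_modp.
Qed.

Hypothesis char0 : forall i, i.+1%:R != 0 :> k.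

Lemma poly_all_roots p : (forall e, p.[e] = 0) -> p = 0.
Proof.
move=> pe; apply/eqP/negPn/negP => p0.
have inj : injective (fun i => i%:R : k).
  suff lt_neq i j : (i < j)%N -> i%:R != j%:R :> k.
    by move=> i j eij; case: (ltngtP i j) => // /lt_neq; rewrite eij eqxx.
  by move=> ij; rewrite eq_sym -subr_eq0 -natrB ?(ltnW ij) // -(subnSK ij) char0.
have := @max_poly_roots k p [seq i%:R | i <- iota 0 (size p)] p0.
rewrite map_inj_uniq // iota_uniq size_map size_iota ltnn => H.
by have : false by apply: H => //; apply/allP => e _; apply/rootP.
Qed.
End Evaluation.

Section RestrictionToSurface.
Variable k : fieldType.
Local Notation B := {mpoly k[3]}.
Local Notation A := {poly {poly k}}.
Variables (m n : nat) (F : {mpoly k[2]}).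
Hypotheses (m_gt1 : (1 < m)%N) (n_gt0 : (0 < n)%N).
Let x : B := varx k.
Let y : B := vary k.
Let z : B := varz k.
Let f : B := x * z - y ^+ m.
Let F' : B := F \mPo [tuple x; f].
Let r : B := x * F' + y * f ^+ n.
Variable h : B.
Hypothesis xh : x * h = f ^+ (m * n + 1) + r ^+ m.
Local Notation fh := (bihorner h f).

Definition Fx0 : {poly k} := mmap (@polyC k) (fun i : 'I_2 => nth 0 [:: 'X; 0] i) F.

(* The restriction of h to the surface f = 0, as a polynomial in x. *)
Definition hx0 : {poly k} := 'X ^+ m.-1 * Fx0 ^+ m.

Lemma eval3_f a b c : eval3 a b c f = a * c - b ^+ m.
Proof. by rewrite /f rmorphB rmorphM rmorphXn /= eval3x eval3y eval3z. Qed.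

Section Restriction.
Variables a b c : {poly k}.
Hypothesis f0 : eval3 a b c f = 0.

Lemma eval3_F : eval3 a b c F' = Fx0 \Po a.
Proof.
rewrite /F' /Fx0; elim/mpoly_ring_ind: F => [e|i|p1 p2 IH1 IH2|p1 p2 IH1 IH2].
- by rewrite comp_mpolyC eval3C mmapC comp_polyC.
- rewrite comp_mpolyXU mmapX mmap1U; case: i => -[|[|//]] i2 /=.
    by rewrite eval3x comp_polyX.
  by rewrite f0 comp_poly0.
- by rewrite comp_mpolyD !rmorphD /= IH1 IH2.
- by rewrite !rmorphM /= IH1 IH2.
Qed.

Hypothesis a0 : a != 0.

(** On f = 0 the relation for x h reads x h = (x F(x, 0))^m, since n >= 1 kills y f^n; x cancels on
    a curve where it is nonzero. *)
Lemma eval3_h : eval3 a b c h = hx0 \Po a.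
Proof.
apply: (mulfI a0); have := congr1 (eval3 a b c) xh.
rewrite rmorphM rmorphD !rmorphXn /= eval3x f0 addn1 expr0n add0r => ->.
rewrite /r rmorphD !rmorphM rmorphXn /= f0 eval3x eval3_F expr0n.
rewrite (gtn_eqF n_gt0) mulr0 addr0 exprMn ?/hx0 ?rmorphM ?rmorphXn /= comp_polyX.
by rewrite mulrA -exprS prednK // ltnW.
Qed.

Lemma eval3_fh (G : A) : eval3 a b c (fh G) = G`_0 \Po (hx0 \Po a).
Proof.
elim/poly_ind: G => [|G p IH]; first by rewrite rmorph0 coef0 comp_poly0 rmorph0.
rewrite rmorphD rmorphM /= bihornerX bihornerC rmorphD rmorphM /= f0 mulr0 add0r.
rewrite coefD coefMX coefC /= add0r -eval3_h.
elim/poly_ind: p => [|p e IHp]; first by rewrite !rmorph0.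
rewrite !rmorphD !rmorphM /= horner_algX horner_algC comp_polyX comp_polyC.
by rewrite IHp -[e%:A]mul_mpolyC mulr1 eval3C.
Qed.
End Restriction.

Lemma eval_axis_f : eval3 'X 0 0 f = 0.
Proof.
rewrite eval3_f expr0n mulr0.
by rewrite gtn_eqF ?subrr // ltnW.
Qed.

Lemma eval_axis_h : eval3 'X 0 0 h = hx0.
Proof. by rewrite (eval3_h eval_axis_f (negbT (polyX_eq0 k))) comp_polyXr. Qed.

Lemma eval_axis_fh (G : A) : eval3 'X 0 0 (fh G) = G`_0 \Po hx0.
Proof. by rewrite (eval3_fh eval_axis_f (negbT (polyX_eq0 k))) comp_polyXr. Qed.

Hypothesis F_gt1 : (1 < size Fx0)%N.

Lemma hx0_gt2 : (2 < size hx0)%N.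
Proof.
have F0 : Fx0 != 0 by rewrite -size_poly_gt0 ltnW.
have Fm0 : Fx0 ^+ m != 0 by rewrite expf_neq0.
rewrite /hx0 size_mul ?expf_neq0 ?polyX_eq0 // size_polyXn prednK; last exact: ltnW.
have := size_exp Fx0 m; case E: (size (Fx0 ^+ m)) => [|d] /=.
  by move/eqP: E; rewrite size_poly_eq0 (negbTE Fm0).
move=> ->; rewrite addnS /=; case: (size Fx0) F_gt1 => [|[|e]] //= _.
apply: (@leq_trans (m + m)); last by rewrite leq_add2l leq_pmull.
exact: (leq_trans _ (leq_add m_gt1 m_gt1)).
Qed.

Lemma poly_split (G : A) : exists H, G = (G`_0)%:P + 'X * H.
Proof.
elim/poly_ind: G => [|G p _]; first by exists 0; rewrite coef0 mulr0 addr0.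
by exists G; rewrite coefD coefMX coefC /= add0r addrC mulrC.
Qed.
End RestrictionToSurface.

(** * No variable is killed by E *)

Section NoVariableInKernel.
Variable k : fieldType.
Local Notation B := {mpoly k[3]}.
Local Notation A := {poly {poly k}}.
Hypothesis char0 : forall i, i.+1%:R != 0 :> k.
Variables (m n : nat) (F : {mpoly k[2]}).
Hypotheses (m_gt1 : (1 < m)%N) (n_gt0 : (0 < n)%N) (F_gt1 : (1 < size (Fx0 F))%N).
Let x : B := varx k.
Let y : B := vary k.
Let z : B := varz k.
Let f : B := x * z - y ^+ m.
Let r : B := x * (F \mPo [tuple x; f]) + y * f ^+ n.
Variable h : B.
Hypothesis xh : x * h = f ^+ (m * n + 1) + r ^+ m.
Local Notation E := (Jac f h).
Local Notation fh := (bihorner h f).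
Local Notation ev1 := (eval3 'X 0 0).
Let q : {poly k} := hx0 m F.

Let ED := @JacD k f h.
Let EM := @JacM k f h.
Let ev1f : ev1 f = 0 := eval_axis_f k m_gt1.
Let ev1h : ev1 h = q := eval_axis_h m_gt1 n_gt0 xh.
Let ev1fh G : ev1 (fh G) = G`_0 \Po q := eval_axis_fh m_gt1 n_gt0 xh G.

Lemma q_gt1 : (1 < size q)%N.
Proof. exact: ltnW (hx0_gt2 m_gt1 F_gt1). Qed.

Lemma q_neq0 : q != 0.
Proof. by rewrite -size_poly_gt0 ltnW // q_gt1. Qed.

Lemma h_neq0 : h != 0.
Proof. by apply: contraNneq q_neq0 => h0; rewrite -ev1h h0 rmorph0. Qed.

Lemma comp_q_inj (p s : {poly k}) : p \Po q = s \Po q -> p = s.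
Proof.
move=> e; apply/eqP; rewrite -subr_eq0; apply/negPn/negP => /(comp_poly_neq0 q_gt1).
by rewrite comp_polyB e subrr eqxx.
Qed.

(** On the x-axis the left side vanishes when i > 0, so a_0(q) = 0; as q is nonconstant, a_0 = 0 and
    one factor f cancels. *)
Lemma strip_f i b (a : A) : f ^+ i * b = fh a -> exists a', b = fh a'.
Proof.
elim: i a => [|i IH] a; first by rewrite expr0 mul1r; exists a.
move=> e; have [a1 aE] := poly_split a.
have a0 : a`_0 = 0.
  apply: comp_q_inj; rewrite -ev1fh -e comp_poly0.
  by rewrite rmorphM rmorphXn /= ev1f expr0n mul0r.
apply: (IH a1); apply: (mulfI (f_neq0 k m)).
by rewrite mulrA -exprS e aE a0 polyC0 add0r rmorphM /= bihornerX.
Qed.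

Variable c : 3.-tuple {mpoly k[3]}.
Hypothesis cc : coord_system c.
Let v : B := tnth c (inord 2).
Hypothesis Ev : E v = 0.

Lemma kernel_variable : exists N (P : A), h ^+ N * v = fh P.
Proof.
have char0B i : i.+1%:R != 0 :> B.
  by rewrite -mpolyC_nat mpolyC_eq0 char0.
have [||N [a]] := @kernel_mod k m n F h xh _ idfun v char0B (f_neq0 k m) h_neq0.
- by move=> a; rewrite /= => ->; exact: (derivation0 ED).
- exact: Ev.
by rewrite exprMn -mulrA => /strip_f[P e]; exists N, P.
Qed.

Let pi : {poly k} := ev1 v.

(* Otherwise v is constant on the surface f = 0, whose tangent cone at the origin
   forces the gradient of v to vanish there. *)
Lemma pi_nonconst : (1 < size pi)%N.
Proof.
rewrite ltnNge; apply/negP => /size1_polyC pi0.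
have [N [P e]] := kernel_variable.
have PE : P`_0 = 'X^N * (pi`_0)%:P.
  apply: comp_q_inj; rewrite -ev1fh -e rmorphM rmorphXn /= ev1h -/pi {1}pi0.
  by rewrite comp_polyM comp_polyC comp_Xn_poly.
(* By [PE], h^N v restricts to q(x)^N times a constant; q(x) is nonzero wherever x is nonconstant,
   and cancels. *)
have vS a b d : eval3 a b d f = 0 -> (1 < size a)%N -> eval3 a b d v = (pi`_0)%:P.
  move=> f0 a_gt1; have a0 : a != 0 by rewrite -size_poly_gt0 ltnW.
  have qa : (q \Po a) ^+ N != 0 by rewrite expf_neq0 // comp_poly_neq0 // q_neq0.
  apply: (mulfI qa).
  have := congr1 (eval3 a b d) e; rewrite rmorphM rmorphXn /=.
  rewrite (eval3_h m_gt1 n_gt0 xh f0 a0) (eval3_fh m_gt1 n_gt0 xh f0 a0) PE -/q => ->.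
  by rewrite comp_polyM comp_polyC comp_Xn_poly.
suff grad0 i : eval3 0 0 0 (mderiv i v) = 0 by apply: (coord_grad cc (ev := eval3 0 0 0) grad0).
have const0 p : eval3 0 0 0 p = (eval3 0 0 0 p).[0]%:P.
  have := eval3_comp 0 0 0 0%:P p; rewrite comp_polyCr => {1}->.
  by rewrite comp_poly0.
rewrite const0; apply/eqP; rewrite polyC_eq0; apply/eqP.
have m0 : (m == 0)%N = false by rewrite gtn_eqF // ltnW.
(* The curves t -> (t^m, e0 t, e0^m) lie in f = 0 and sweep out the z-axis at t = 0. The z-axis is
   parametrised as (0, 0, t^m) so that the parameter e0 gives that same point. *)
have on_curve (e0 : k) p :
    (eval3 'X^m (e0 *: 'X) (e0 ^+ m)%:P p).[0] = (eval3 0 0 'X^m p).[e0].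
  by apply: eval3_horner; rewrite !hornerE ?hornerXn ?expr0n ?m0 ?mulr0.
have origin p : (eval3 0 0 'X^m p).[0] = (eval3 0 0 0 p).[0].
  by apply: eval3_horner; rewrite !hornerE ?hornerXn ?expr0n ?m0.
have curve (e0 : k) : eval3 'X^m (e0 *: 'X) (e0 ^+ m)%:P v = (pi`_0)%:P.
  apply: vS; last by rewrite size_polyXn ltnS ltnW.
  rewrite eval3_f exprZn mulrC mul_polyC.
  by rewrite subrr.
have onz : eval3 0 0 'X^m v = (pi`_0)%:P.
  apply/eqP; rewrite -subr_eq0; apply/eqP/(poly_all_roots char0) => e0.
  rewrite hornerD hornerN hornerC; have := congr1 (fun p : {poly k} => p.[0]) (curve e0).
  by rewrite hornerC on_curve => ->; rewrite subrr.
have [i0|[i1|i2]] : i = inord 0 \/ (i = inord 1 \/ i = inord 2).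
  rewrite -[i]inord_val; case: i => -[|[|[|//]]] ilt /=; by [left|right; left|right; right].
- have := eval3_deriv 'X 0 0 v; rewrite -/pi pi0 derivC derivX linear0 !mulr0 !addr0 mulr1.
  rewrite i0 => e1; transitivity (ev1 (mderiv (inord 0) v)).[0]; last by rewrite -e1 horner0.
  by apply: eval3_horner; rewrite ?hornerX ?horner0.
(* At t = 0 the velocity of these curves is (0, e0, 0) because m >= 2, so e0 times the y-derivative
   vanishes for every e0. *)
- rewrite i1 -origin; suff -> : eval3 0 0 'X^m (mderiv (inord 1) v) = 0 by rewrite horner0.
  apply: (mulfI (negbT (polyX_eq0 k))); rewrite mulr0; apply: (poly_all_roots char0) => e0.
  have := eval3_deriv 'X^m (e0 *: 'X) (e0 ^+ m)%:P v.
  rewrite curve !derivC mulr0 addr0 derivXn derivZ derivX.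
  move/(congr1 (fun p : {poly k} => p.[0])); rewrite horner0 !hornerE hornerMn hornerXn expr0n.
  have -> : (m.-1 == 0)%N = false by case: (m) m_gt1 => [|[|]].
  rewrite !on_curve mul0rn mulr0 add0r; move: (eval3 0 0 _ _).[_] => t.
  by rewrite /= mulr1 mulrC => <-.
- rewrite i2 -origin; suff -> : eval3 0 0 'X^m (mderiv (inord 2) v) = 0 by rewrite horner0.
  have := eval3_deriv 0 0 'X^m v; rewrite onz derivC linear0 !mulr0 !add0r derivXn.
  move/eqP; rewrite eq_sym mulf_eq0 => /orP[/eqP//|].
  rewrite -mulr_natr mulf_eq0 expf_eq0 polyX_eq0 andbF /= -polyC_natr polyC_eq0.
  by case: (m) m_gt1 => // j _; rewrite (negbTE (char0 j)).
Qed.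

Lemma fh_sub_const (P : A) (e : k) N : fh (P - (e%:P * 'X^N)%:P) = fh P - e%:MP * h ^+ N.
Proof.
rewrite bihornerB bihornerC.
have -> : horner_alg h (e%:P * 'X^N) = horner_alg h e%:P * horner_alg h 'X^N by exact: rmorphM.
have -> : horner_alg h 'X^N = h ^+ N by rewrite -[in RHS](horner_algX h); exact: rmorphXn.
by rewrite horner_algC -[e%:A]mul_mpolyC mulr1.
Qed.

(* On the plane v = v(beta, 0, 0), identified with k^2, the component x = beta of f = 0 has an
   equation g. It is a polynomial in f and h (up to a power of h), hence cannot tell x = beta
   from the other roots of q = q(beta). *)
Lemma no_variable_in_kernel : False.
Proof.
have [N [P vE]] := kernel_variable.
have [beta qb] : exists beta, q.[beta] != 0.
  apply: NNPP => no; case/eqP: q_neq0; apply: (poly_all_roots char0) => e.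
  by apply/eqP/negPn/negP => qe; apply: no; exists e.
have b0 : beta != 0.
  apply: contraNneq qb => ->; rewrite /q /hx0 hornerM hornerXn expr0n.
  by case: (m) m_gt1 => [|[|j]] //= _; rewrite mul0r.
pose kap := q.[beta]; pose cst := pi.[beta]; pose V : B := v - cst%:MP.
have qpi : q ^+ N * pi = P`_0 \Po q.
  by rewrite -ev1fh -vE rmorphM rmorphXn /= ev1h.
have PK : kap ^+ N * cst = (P`_0).[kap].
  by have := congr1 (horner^~ beta) qpi; rewrite /= hornerM horner_exp horner_comp.
have ev1V : ev1 V = pi - cst%:P by rewrite rmorphB /= eval3C.
(* The component x = beta of f = 0, parametrised by y. On it h is constantly [kap], hence v is
   constantly [cst], so it lies in the plane V = 0. *)
pose evb := eval3 beta%:P 'X (beta^-1 *: 'X^m).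
have evbf : evb f = 0.
  by rewrite /evb eval3_f mul_polyC scalerA mulfV // scale1r subrr.
have bP0 : beta%:P != 0 :> {poly k} by rewrite polyC_eq0.
have evbv : evb v = cst%:P.
  have K0 : (kap ^+ N)%:P != 0 :> {poly k} by rewrite polyC_eq0 expf_neq0.
  apply: (mulfI K0); have := congr1 evb vE; rewrite rmorphM rmorphXn /=.
  rewrite (eval3_h m_gt1 n_gt0 xh evbf bP0) (eval3_fh m_gt1 n_gt0 xh evbf bP0) -/q.
  by rewrite !comp_polyCr -/kap -PK -polyC_exp polyCM => ->.
pose hC : {rmorphism k -> A} := (@polyC {poly k}) \o (@polyC k).
(* Restriction to the plane V = 0, with the two other coordinates as u and w; [lam] below is a
   section of it. *)
have [psi [psiC psiX]] := coord_rmorph char0 cc hC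
  (fun i => nth 0 [:: 'X%:P; 'X; cst%:P%:P] i).
have psiX0 : psi (tnth c (inord 0)) = 'X%:P by rewrite psiX inordK.
have psiX1 : psi (tnth c (inord 1)) = 'X by rewrite psiX inordK.
have psiV : psi V = 0 by rewrite rmorphB /= psiC psiX inordK // subrr.
have ord3P (Q : 'I_3 -> Prop) : Q (inord 0) -> Q (inord 1) -> Q (inord 2) -> forall i, Q i.
  by move=> Q0 Q1 Q2 i; rewrite -[i]inord_val; case: i => -[|[|[|//]]] ilt /=.
pose lam : {rmorphism A -> B} := bihorner (tnth c (inord 0)) (tnth c (inord 1)).
have psilam G : psi (lam G) = G.
  elim/poly_ind: G => [|G p IH]; first by rewrite !rmorph0.
  rewrite !rmorphD !rmorphM /= IH bihornerX psiX1 bihornerC; congr (_ + _).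
  elim/poly_ind: p => [|p e IHp]; first by rewrite !rmorph0.
  by rewrite !rmorphD !rmorphM /= IHp horner_algX psiX0 horner_algC -mul_mpolyC mulr1 psiC.
have kerpsi b : psi b = 0 -> exists t, b = V * t.
  suff [t tP] : exists t, b - lam (psi b) = V * t.
    by move=> pb; exists t; rewrite -tP pb rmorph0 subr0.
  elim/(coord_ind cc): b => [e|i|u w [s sP] [t tP]|u w [s sP] [t tP]].
  - by exists 0; rewrite psiC /= bihornerC horner_algC -mul_mpolyC mulr1 subrr mulr0.
  - elim/ord3P: i.
    + by exists 0; rewrite psiX0 /= bihornerC horner_algX subrr mulr0.
    + by exists 0; rewrite psiX1 /= bihornerX subrr mulr0.
    + by exists 1; rewrite mulr1 psiX inordK //= bihornerC horner_algC -mul_mpolyC mulr1.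
  - exists (s + t); rewrite !rmorphD mulrDr -sP -tP /=; ring.
  - exists (s * w + lam (psi u) * t); rewrite !rmorphM /= mulrDr mulrA -sP mulrCA -tP /=; ring.
have EV : E V = 0.
  by rewrite ED (derivationN ED) JacC Ev subr0.
have psiE a : psi a = 0 -> psi (E a) = 0.
  by case/kerpsi => t ->; rewrite EM EV mulr0 addr0 rmorphM psiV mul0r.
pose al := evb (tnth c (inord 0)); pose om := evb (tnth c (inord 1)).
(* The curve lies in the plane, with coordinates [al] and [om] there. *)
have phipsi b : bihorner al om (psi b) = evb b.
  elim/(coord_ind cc): b => [e|i|u w IHu IHw|u w IHu IHw].
  - by rewrite psiC /= bihornerC horner_algC /evb eval3C -mul_polyC mulr1.
  - elim/ord3P: i.
    + by rewrite psiX0 bihornerC horner_algX.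
    + by rewrite psiX1 bihornerX.
    + by rewrite evbv psiX inordK //= bihornerC horner_algC -mul_polyC mulr1.
  - by rewrite !rmorphD /= IHu IHw.
  - by rewrite !rmorphM /= IHu IHw.
have alom : (1 < size al)%N || (1 < size om)%N.
  apply/negPn/negP; rewrite negb_or -!leqNgt => /andP[/size1_polyC al1 /size1_polyC om1].
  have [e ye] : exists e, evb y = e%:P.
    elim/(coord_ind cc): y => [e|i|u w [s sP] [t tP]|u w [s sP] [t tP]].
    - by exists e; rewrite /evb eval3C.
    - elim/ord3P: i; [by exists al`_0|by exists om`_0|by exists cst].
    - by exists (s + t); rewrite rmorphD /= sP tP polyCD.
    - by exists (s * t); rewrite rmorphM /= sP tP polyCM.
  have := size_polyX k; rewrite -(eval3y beta%:P 'X (beta^-1 *: 'X^m)) -/evb -/y ye size_polyC.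
  by case: (e != 0).
have pi0 : pi - cst%:P != 0.
  by rewrite subr_eq0; apply: contraTneq pi_nonconst => ->; rewrite size_polyC; case: (cst != 0).
have pib : (pi - cst%:P).[beta] = 0 by rewrite hornerD hornerN hornerC subrr.
have pibM s : ((pi - cst%:P) * s).[beta] = 0 by rewrite hornerM pib mul0r.
(* If f = V t, then t vanishes on the x-axis; comparing z-derivatives there gives x = V dt/dz, which
   fails at x = beta. *)
have psif : psi f != 0.
  apply/eqP => /kerpsi[t ft].
  have t0 : ev1 t = 0.
    by apply: (mulfI pi0); rewrite -ev1V -rmorphM -ft mulr0.
  have := congr1 (fun b => ev1 (mderiv (inord 2) b)) ft.
  rewrite (mderiv_z_f k m) mderivM rmorphD !rmorphM /= ev1V t0 mulr0 add0r eval3x.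
  move/(congr1 (horner^~ beta)); rewrite /= hornerX pibM.
  by move/eqP; rewrite (negbTE b0).
have psih : psi h != 0.
  apply/eqP => /kerpsi[t ht].
  have := congr1 ev1 ht; rewrite ev1h rmorphM /= ev1V => /(congr1 (horner^~ beta)).
  by rewrite /= pibM => /eqP; rewrite (negbTE qb).
have [||K [Kk [[G' fG] [H' xH]]]] :=
    @kernel_common_divisor k al om (psi f) (psi (x - beta%:MP)) alom psif.
- by rewrite phipsi evbf.
- by rewrite phipsi rmorphB /= /evb eval3C eval3x subrr.
pose g := lam K; pose t1 := lam G'; pose t2 := lam H'.
(* The point (beta, 0, 0) lies both on the x-axis and on the curve. *)
have gb : (ev1 g).[beta] = 0.
  have -> : (ev1 g).[beta] = (evb g).[0].
    apply: eval3_horner; rewrite ?hornerE //=.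
    by rewrite ?hornerXn expr0n gtn_eqF ?mulr0 // ltnW.
  by rewrite -phipsi psilam Kk horner0.
have ft : psi f = psi (g * t1) by rewrite rmorphM /= !psilam.
have char0A i : i.+1%:R != 0 :> A by rewrite -!polyC_natr !polyC_eq0.
have Eg : psi (E g) = 0.
  apply: (@factorially_closed _ _ ED EM _ psi char0A psiE (E_nilpotent xh h_neq0) g t1).
    by rewrite -ft.
  have : psi (E (g * t1 - f)) = 0 by apply: psiE; rewrite rmorphB /= ft subrr.
  by rewrite ED (derivationN ED) E_f subr0.
have [N1 [a0 ga0]] := kernel_mod xh char0A psif psih psiE Eg.
pose D : A := P - (cst%:P * 'X^N)%:P.
have fhD : fh D = h ^+ N * V.
  by rewrite fh_sub_const -vE /V mulrBr [_ * cst%:MP]mulrC.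
have D0 : D`_0 \Po q = q ^+ N * (pi - cst%:P).
  by rewrite -ev1fh fhD rmorphM rmorphXn /= ev1h ev1V.
(* Removal of f modulo V. On the axis a_0(q) is a multiple of V, so D_0 divides X^N a_0 with some
   quotient S; then X^N a - S D has no f-free term, and represents h^N a modulo V because D
   represents h^N V. *)
have strip i l a : psi (f ^+ i * (h ^+ l * g)) = psi (fh a) ->
    exists l' a', psi (h ^+ l' * g) = psi (fh a').
  elim: i l a => [|i IH] l a; first by rewrite expr0 mul1r; exists l, a.
  move=> e; have [t tP] : exists t, f ^+ i.+1 * (h ^+ l * g) - fh a = V * t.
    by apply: kerpsi; rewrite rmorphB /= e subrr.
  have : D`_0 \Po q %| ('X^N * a`_0) \Po q.
    rewrite D0 comp_polyM comp_Xn_poly dvdp_mul2l ?expf_neq0 ?q_neq0 //.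
    have := congr1 ev1 tP; rewrite rmorphB !rmorphM rmorphXn /= ev1f expr0n mul0r sub0r.
    by rewrite ev1fh ev1V => /eqP; rewrite eqr_oppLR => /eqP ->; rewrite -mulrN dvdp_mulr.
  move/(dvdp_comp_inv q_gt1)/dvdpP => [S SP].
  have [a1 aE] := poly_split a; have [D1 DE] := poly_split D.
  apply: (IH (l + N)%N ('X^N%:P * a1 - S%:P * D1)).
  apply: (mulfI psif); rewrite -!rmorphM.
  have -> : f * fh ('X^N%:P * a1 - S%:P * D1) = h ^+ N * fh a - fh S%:P * (h ^+ N * V).
    have fX G : f * fh G = fh ('X * G) by rewrite bihornerM bihornerX.
    rewrite -fhD fX.
    have -> : h ^+ N = fh ('X^N)%:P by rewrite bihornerC rmorphXn /= horner_algX.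
    rewrite -!bihornerM -bihornerB; congr (fh _).
    have -> : 'X^N%:P * a = (S * D`_0)%:P + 'X^N%:P * ('X * a1).
      by rewrite {1}aE mulrDr -polyCM SP.
    by rewrite {2}DE polyCM; ring.
  rewrite rmorphB !rmorphM /= psiV !mulr0 subr0 -e !rmorphM !rmorphXn /= exprS exprD.
  ring.
have [l [a la]] : exists l a, psi (h ^+ l * g) = psi (fh a).
  by apply: (strip N1 N1 a0); rewrite -ga0 exprMn mulrA.
have [T1 T1P] : exists t, h ^+ l * g - fh a = V * t.
  by apply: kerpsi; rewrite rmorphB /= la subrr.
have [T2 T2P] : exists t, x - beta%:MP - g * t2 = V * t.
  by apply: kerpsi; rewrite rmorphB /= xH rmorphM /= !psilam subrr.
pose del := ('X - kap%:P) \Po q.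
have delE : del = q - kap%:P by rewrite /del comp_polyB comp_polyX comp_polyC.
(* A polynomial in q that vanishes at beta is divisible by all of q - q(beta). This applies to q^N
   (pi - cst) and to a_0(q), the axis value of h^l g modulo V. *)
have del_dvd (s : {poly k}) : s.[kap] = 0 -> del %| s \Po q.
  by move=> s0; apply: dvdp_comp_poly; rewrite dvdp_XsubCl; apply/rootP.
have e1 : q ^+ l * ev1 g = a`_0 \Po q + (pi - cst%:P) * ev1 T1.
  rewrite -ev1V -rmorphM -T1P rmorphB rmorphM rmorphXn /= ev1h ev1fh; ring.
have a_kap : (a`_0).[kap] = 0.
  have := congr1 (horner^~ beta) e1.
  by rewrite /= hornerM gb mulr0 hornerD horner_comp pibM addr0.
have delD : del %| q ^+ N * (pi - cst%:P).
  rewrite -D0; apply: del_dvd; rewrite /D coefB coefC /= hornerD hornerN hornerM hornerC hornerXn.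
  by rewrite -PK mulrC subrr.
have e2 : 'X - beta%:P = ev1 g * ev1 t2 + (pi - cst%:P) * ev1 T2.
  rewrite -ev1V -!rmorphM -T2P !rmorphB /= eval3x eval3C; ring.
have del1 : del %| q ^+ (N + l) * ('X - beta%:P).
  have -> : q ^+ (N + l) * ('X - beta%:P) =
      q ^+ N * ev1 t2 * (a`_0 \Po q) + q ^+ N * (pi - cst%:P) * (ev1 T1 * ev1 t2 + q ^+ l * ev1 T2).
    rewrite e2 exprD.
    transitivity (q ^+ N * ev1 t2 * (q ^+ l * ev1 g) + q ^+ N * (pi - cst%:P) * (q ^+ l * ev1 T2)).
      by ring.
    by rewrite e1; ring.
  by apply: dvdp_add; [apply: dvdp_mull; exact: del_dvd|exact: dvdp_mulr].
(* Modulo q - kap, the power of q is the nonzero constant kap^(N+l). *)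
have del2 : del %| 'X - beta%:P.
  have K0 : kap ^+ (N + l) != 0 by rewrite expf_neq0.
  rewrite -(dvdpZr _ _ K0) -mul_polyC.
  have -> : (kap ^+ (N + l))%:P = q ^+ (N + l) - (q ^+ (N + l) - kap%:P ^+ (N + l)).
    by rewrite polyC_exp; ring.
  by rewrite mulrBl dvdp_sub // dvdp_mulr // subrXX -delE dvdp_mulr.
have := dvdp_leq (negbT (polyXsubC_eq0 beta)) del2.
rewrite size_XsubC delE size_polyDl; last first.
  rewrite size_polyN (leq_ltn_trans _ q_gt1) // size_polyC; by case: (kap != 0).
by rewrite leqNgt (hx0_gt2 m_gt1 F_gt1).
Qed.
End NoVariableInKernel.

(** * The hypothesis on F, the rank condition, and the conclusion *)

Lemma size_Fx0 (k : fieldType) (F : {mpoly k[2]}) :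
  (forall c : k, F \mPo [tuple ('X_(inord 0 : 'I_2) : {mpoly k[2]}); 0] <> c%:MP) ->
  (1 < size (Fx0 F))%N.
Proof.
move=> hF; rewrite ltnNge; apply/negP => /size1_polyC F0.
pose X0 : {mpoly k[2]} := 'X_(inord 0).
suff e : F \mPo [tuple X0; 0] = horner_alg X0 (Fx0 F).
  by apply: (hF (Fx0 F)`_0); rewrite e F0 horner_algC -mul_mpolyC mulr1 coefC.
rewrite /Fx0; elim/mpoly_ring_ind: F {hF F0} => [c|i|p1 p2 IH1 IH2|p1 p2 IH1 IH2].
- by rewrite comp_mpolyC mmapC horner_algC -mul_mpolyC mulr1.
- rewrite comp_mpolyXU mmapX mmap1U; case: i => -[|[|//]] i2 /=.
    by rewrite horner_algX.
  by rewrite rmorph0.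
- by rewrite comp_mpolyD !rmorphD /= IH1 IH2.
- by rewrite !rmorphM /= IH1 IH2.
Qed.

(** For i at most 2 the last coordinate is among those whose polynomials lie in the kernel. *)
Lemma rank_cond_small (k : fieldType) (E : {mpoly k[3]} -> {mpoly k[3]}) i :
  (i < 3)%N -> rank_cond E i ->
  exists2 c : 3.-tuple {mpoly k[3]}, coord_system c & E (tnth c (inord 2)) = 0.
Proof.
move=> i3 [c [cc cE]]; exists c => //.
suff <- : 'X_(inord 2) \mPo c = tnth c (inord 2).
  apply: cE => mo; rewrite msuppX inE => /eqP -> j ji; rewrite mnm1E; case: eqP => // j2.
  by move: ji; rewrite -j2 inordK // ltnNge -ltnS i3.
by rewrite comp_mpolyXU -tnth_nth.
Qed.

(** For i = 3 no variable is allowed to occur, so only constants have to be killed. *)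
Lemma rank_cond3 (k : fieldType) (E : {mpoly k[3]} -> {mpoly k[3]}) :
  (forall c : k, E c%:MP = 0) -> rank_cond E 3.
Proof.
move=> EC; exists [tuple 'X_i | i < 3]; split=> [q|g g3].
  by exists q; rewrite comp_mpoly_id.
suff -> : g = (g@_0)%:MP by rewrite comp_mpolyC EC.
apply/mpolyP => mo; rewrite mcoeffC; have [<-|mo0] := eqVneq 0%MM mo; first by rewrite mulr1.
rewrite mulr0; apply: memN_msupp_eq0; apply: contra mo0 => /g3 mo3.
by apply/eqP/mnmP => j; rewrite mnm0E mo3.
Qed.

Theorem theorem5p7 (k : fieldType) (hchar : [pchar k] =i pred0)
  (m n : nat) (hm : (2 <= m)%N) (hn : (1 <= n)%N) (F : {mpoly k[2]})
  (hF : forall c : k, F \mPo [tuple ('X_(inord 0 : 'I_2) : {mpoly k[2]}); 0] <> c%:MP) :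
  let x := varx k in let y := vary k in let z := varz k in
  let f := x * z - y ^+ m in
  let r := x * (F \mPo [tuple x; f]) + y * f ^+ n in
  (exists h : {mpoly k[3]}, x * h = f ^+ (m * n + 1) + r ^+ m) /\
  forall h : {mpoly k[3]}, x * h = f ^+ (m * n + 1) + r ^+ m ->
    is_derivation (Jac f h) /\ locally_nilpotent (Jac f h) /\
    has_rank (Jac f h) 3.
Proof.
move=> x y z f r; split; first exact: exists_h.
move=> h xh; have F_gt1 := size_Fx0 hF.
have char0 i : i.+1%:R != 0 :> k by rewrite ((pcharf0P k).1 hchar).
split; first exact: Jac_is_derivation.
split; first exact: E_nilpotent xh (h_neq0 hm hn F_gt1 xh).
split=> [|i i3 /(rank_cond_small i3)[c cc Ev]]; first by apply: rank_cond3 => c; exact: JacC.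
exact: (no_variable_in_kernel char0 hm hn F_gt1 xh cc Ev).
Qed.
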